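(* For every signature $\tau$, every sentence of ${\rm FO}(\subseteq)[\tau]$ is logically equivalent to some sentence of ${\rm FO}(\subseteq)[\tau]$ in which at most one universal quantifier occurs. Hence ${\rm FO}(\subseteq)(1\forall) = {\rm FO}(\subseteq)$.
   Context: Inclusion logic ${\rm FO}(\subseteq)$ over a signature $\tau$ consists of formulae in negation normal form generated by $\phi ::= \bar x_1 \subseteq \bar x_2 \mid t_1 = t_2 \mid \neg t_1 = t_2 \mid R(\bar t) \mid \neg R(\bar t) \mid (\phi \wedge \psi) \mid (\phi \vee \psi) \mid \forall x \phi \mid \exists x \phi$, where in an inclusion atom $\bar x_1 \subseteq \bar x_2$ the tuples $\bar x_1,\bar x_2$ are tuples of variables of the same length. Models are assumed to have at least two elements. A team $X$ over a model $\mathfrak{M}$ with domain $M$ is a set of assignments with a common finite domain of variables. Lax team semantics: for a first-order literal $\alpha$, $\mathfrak{M}\models_X \alpha$ iff every $s\in X$ satisfies $\alpha$ in the usual Tarskian sense; $\mathfrak{M}\models_X \bar x_1\subseteq \bar x_2$ iff for every $s\in X$ there is $s'\in X$ with $s(\bar x_1)=s'(\bar x_2)$; $\mathfrak{M}\models_X\phi\wedge\psi$ iff $\mathfrak{M}\models_X\phi$ and $\mathfrak{M}\models_X\psi$; $\mathfrak{M}\models_X\phi\vee\psi$ iff there are teams $Y,Z$ with $Y\cup Z=X$, $\mathfrak{M}\models_Y\phi$ and $\mathfrak{M}\models_Z\psi$; $\mathfrak{M}\models_X\exists x\phi$ iff $\mathfrak{M}\models_{X[F/x]}\phi$ for some function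 $F:X\to\mathcal{P}(M)\setminus\{\emptyset\}$, where $X[F/x]=\{s(a/x)\mid s\in X, a\in F(s)\}$; $\mathfrak{M}\models_X\forall x\phi$ iff $\mathfrak{M}\models_{X[M/x]}\phi$, where $X[M/x]=\{s(a/x)\mid s\in X,a\in M\}$. A sentence $\phi$ is true in $\mathfrak{M}$ iff $\mathfrak{M}\models_{\{\emptyset\}}\phi$ (the team containing only the empty assignment). Two sentences are logically equivalent if they are true in exactly the same models. ${\rm FO}(\subseteq)(k\forall)$ denotes the formulae of ${\rm FO}(\subseteq)$ in which at most $k$ universal quantifiers occur. For logics $\mathcal{L},\mathcal{L}'$, $\mathcal{L}\le\mathcal{L}'$ means that for every signature $\tau$ every $\mathcal{L}[\tau]$-sentence is logically equivalent to some $\mathcal{L}'[\tau]$-sentence; $=$ means $\le$ in both directions. *)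

(* Defs.v *)
From mathcomp Require Import all_boot.
Set Implicit Arguments. Unset Strict Implicit. Unset Printing Implicit Defensive.

(* A first-order signature: relation symbols and function symbols
   (constants = 0-ary function symbols), each with an arity. *)
Record signature := Signature {
  rsym : Type; rar : rsym -> nat;
  fsym : Type; far : fsym -> nat }.

Definition var := nat.

Inductive term (tau : signature) : Type :=
| TVar : var -> term tau
| TFun : forall f : fsym tau, ('I_(far f) -> term tau) -> term tau.

(* Formulae of FO(⊆)[tau] in negation normal form. An inclusion atom
   x̄1 ⊆ x̄2 has two variable tuples of the same length n. *)
Inductive formula (tau : signature) : Type :=
| FInc : forall n : nat, ('I_n -> var) -> ('I_n -> var) -> formula tau
| FEq : term tau -> term tau -> formula tau
| FNeq : term tau -> term tau -> formula tau
| FRel : forall R : rsym tau, ('I_(rar R) -> term tau) -> formula tau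
| FNRel : forall R : rsym tau, ('I_(rar R) -> term tau) -> formula tau
| FAnd : formula tau -> formula tau -> formula tau
| FOr : formula tau -> formula tau -> formula tau
| FAll : var -> formula tau -> formula tau
| FEx : var -> formula tau -> formula tau.

Arguments TVar {tau}.
Arguments FInc {tau n}.

Fixpoint occurs tau (v : var) (t : term tau) : Prop :=
  match t with
  | TVar w => v = w
  | TFun f a => exists i, occurs v (a i)
  end.

Fixpoint free tau (v : var) (phi : formula tau) : Prop :=
  match phi with
  | FInc n xs ys => exists i, v = xs i \/ v = ys i
  | FEq t1 t2 | FNeq t1 t2 => occurs v t1 \/ occurs v t2
  | FRel R ts | FNRel R ts => exists i, occurs v (ts i)
  | FAnd p q | FOr p q => free v p \/ free v q
  | FAll x p | FEx x p => v <> x /\ free v p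
  end.

Definition sentence tau (phi : formula tau) : Prop := forall v, ~ free v phi.

Fixpoint nforall tau (phi : formula tau) : nat :=
  match phi with
  | FAnd p q | FOr p q => nforall p + nforall q
  | FAll _ p => (nforall p).+1
  | FEx _ p => nforall p
  | _ => 0
  end.

Record structure (tau : signature) (M : Type) := Structure {
  rel_of : forall R : rsym tau, ('I_(rar R) -> M) -> Prop;
  fun_of : forall f : fsym tau, ('I_(far f) -> M) -> M }.

Definition assignment (M : Type) := var -> option M.
Definition team (M : Type) := assignment M -> Prop.

Definition upd M (s : assignment M) (x : var) (a : M) : assignment M :=
  fun y => if y == x then Some a else s y.

(* Evaluation of terms (as a relation; a term has a value iff all its
   variables are defined). *)
Inductive evals tau M (S : structure tau M) (s : assignment M) : term tau -> M -> Prop :=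
| ev_var : forall v a, s v = Some a -> evals S s (TVar v) a
| ev_fun : forall f args (vals : 'I_(far f) -> M),
    (forall i, evals S s (args i) (vals i)) ->
    evals S s (TFun args) (fun_of S vals).

Fixpoint sat tau M (S : structure tau M) (phi : formula tau) (X : team M) : Prop :=
  match phi with
  | FInc n xs ys =>
      forall s, X s -> exists s', X s' /\ forall i, s (xs i) = s' (ys i)
  | FEq t1 t2 =>
      forall s, X s -> exists a, evals S s t1 a /\ evals S s t2 a
  | FNeq t1 t2 =>
      forall s, X s -> exists a b, evals S s t1 a /\ evals S s t2 b /\ a <> b
  | FRel R ts =>
      forall s, X s -> exists vals, (forall i, evals S s (ts i) (vals i)) /\ rel_of S vals
  | FNRel R ts =>
      forall s, X s -> exists vals, (forall i, evals S s (ts i) (vals i)) /\ ~ rel_of S vals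
  | FAnd p q => sat S p X /\ sat S q X
  | FOr p q => exists Y Z : team M,
      (forall s, X s <-> Y s \/ Z s) /\ sat S p Y /\ sat S q Z
  | FAll x p =>
      sat S p (fun s' => exists s a, X s /\ s' = upd s x a)
  | FEx x p =>
      exists F : assignment M -> M -> Prop,
        (forall s, X s -> exists a, F s a) /\
        sat S p (fun s' => exists s a, X s /\ F s a /\ s' = upd s x a)
  end.

Definition empty_team M : team M := fun s => s = (fun _ => None).

Definition true_in tau M (S : structure tau M) (phi : formula tau) : Prop :=
  sat S phi (@empty_team M).

Definition equivalent tau (phi psi : formula tau) : Prop :=
  forall (M : Type) (S : structure tau M), (exists a b : M, a <> b) ->
    (true_in S phi <-> true_in S psi).

(* Main.v *)
(* Idea: every sentence is brought to the form ∃x_1 ... ∃x_n ∀x_0 theta with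
   theta quantifier-free.  Under lax semantics and locality, a block of
   existential quantifiers asks for a team that restricts to the given one.  So
   ∀x_m can be replaced by ∃x_m together with the inclusion atom
   x_0 x_1 ... x_(m-1) ⊆ x_m x_1 ... x_(m-1), where x_0 is universally
   quantified last: the atom says that x_m takes all values over each
   x_1 ... x_(m-1).  A disjunction is pulled below the prefixes of its disjuncts
   by two fresh existential variables, whose equality records the disjunct. *)

Require Import Defs.
From Corelib Require Import Setoid.
From mathcomp Require Import all_boot.

Set Implicit Arguments. Unset Strict Implicit. Unset Printing Implicit Defensive.

(** * Agreement of teams on a set of variables, and locality *)

(** Equality of the restrictions of two teams to [V]. The value type [D] is left general to cover
    both partial assignments and total ones. *)
Definition agree D (V : var -> Prop) (X Y : (var -> D) -> Prop) : Prop :=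
  (forall s, X s -> exists2 s', Y s' & forall v, V v -> s v = s' v) /\
  (forall s', Y s' -> exists2 s, X s & forall v, V v -> s v = s' v).

Lemma agree_refl D V (X : (var -> D) -> Prop) : agree V X X.
Proof. by split=> s Xs; exists s. Qed.

Lemma agree_sym D V (X Y : (var -> D) -> Prop) : agree V X Y -> agree V Y X.
Proof.
case=> XY YX; split=> s /[dup] Hs.
  by move/YX => [s' Xs' E]; exists s' => // v Vv; rewrite E.
by move/XY => [s' Xs' E]; exists s' => // v Vv; rewrite E.
Qed.

Lemma agree_trans D V (X Y Z : (var -> D) -> Prop) :
  agree V X Y -> agree V Y Z -> agree V X Z.
Proof.
case=> XY YX [YZ ZY]; split=> s Hs.
  have [t Yt st] := XY s Hs; have [u Zu tu] := YZ t Yt.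
  by exists u => // v Vv; rewrite st // tu.
have [t Yt st] := ZY s Hs; have [u Zu tu] := YX t Yt.
by exists u => // v Vv; rewrite tu // st.
Qed.

Lemma agree_sub D (V W : var -> Prop) (X Y : (var -> D) -> Prop) :
  (forall v, V v -> W v) -> agree W X Y -> agree V X Y.
Proof.
move=> VW [XY YX]; split=> s Hs.
  by have [t Yt st] := XY s Hs; exists t => // v /VW/st.
by have [t Yt st] := YX s Hs; exists t => // v /VW/st.
Qed.

Lemma evals_agree tau M (S : structure tau M) s s' t a :
  evals S s t a -> (forall v, occurs v t -> s v = s' v) -> evals S s' t a.
Proof.
elim=> [v b sv | f args vals _ IH] E; first by constructor; rewrite -E.
by constructor=> i; apply: IH => v Hv; apply: E; exists i.
Qed.

(** Locality of lax semantics. Splits and choice functions are carried from [X] to [Y] along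
    matching assignments, where several assignments of one team may match the same one of the
    other. *)
Lemma sat_agree tau M (S : structure tau M) phi X Y :
  agree (fun v => free v phi) X Y -> sat S phi X -> sat S phi Y.
Proof.
elim: phi X Y => [n xs ys|t1 t2|t1 t2|R ts|R ts|p IHp q IHq|p IHp q IHq|x p IH|x p IH]
  X Y [XY YX] /=.
- move=> H s' /YX[s Xs E]; have [u [Xu Eu]] := H s Xs.
  have [u' Yu' Eu'] := XY u Xu; exists u'; split=> // i.
  rewrite -E; last by exists i; left.
  by rewrite Eu Eu' //; exists i; right.
- move=> H s' /YX[s Xs E]; have [a [e1 e2]] := H s Xs; exists a.
  by split; [apply: (evals_agree e1) | apply: (evals_agree e2)] => v Hv;
    apply: E; [left | right].
- move=> H s' /YX[s Xs E]; have [a [b [e1 [e2 ab]]]] := H s Xs; exists a, b.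
  split; first by apply: (evals_agree e1) => v Hv; apply: E; left.
  by split=> //; apply: (evals_agree e2) => v Hv; apply: E; right.
- move=> H s' /YX[s Xs E]; have [vals [e r]] := H s Xs; exists vals; split=> // i.
  by apply: (evals_agree (e i)) => v Hv; apply: E; exists i.
- move=> H s' /YX[s Xs E]; have [vals [e r]] := H s Xs; exists vals; split=> // i.
  by apply: (evals_agree (e i)) => v Hv; apply: E; exists i.
- case=> Hp Hq; split.
    by apply: IHp Hp; apply: (agree_sub (W := fun v => free v (FAnd p q))) => // v Hv; left.
  by apply: IHq Hq; apply: (agree_sub (W := fun v => free v (FAnd p q))) => // v Hv; right.
- case=> X1 [X2 [EX [Hp Hq]]].
  (* A subteam of [X] is carried to the assignments of [Y] that match one of its members; the two
     parts may overlap. *)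
  pose part (X' : team M) : team M := fun s' => Y s' /\
    exists2 s, X' s & forall v, free v (FOr p q) -> s v = s' v.
  exists (part X1), (part X2); split; [|split].
  + move=> s'; split; last by move=> [[]|[]].
    move=> Ys'; have [s /EX[Xs|Xs] E] := YX s' Ys'; [left | right]; split=> //; by exists s.
  + apply: IHp Hp; split=> s.
      move=> X1s; have [s' Ys' E] : exists2 s', Y s' & forall v, free v (FOr p q) -> s v = s' v.
        by apply: XY; apply/EX; left.
      exists s' => [|v Hv]; last by apply: E; left.
      by split=> //; exists s.
    by case=> _ [s' Hs' E]; exists s' => // v Hv; apply: E; left.
  + apply: IHq Hq; split=> s.
      move=> X1s; have [s' Ys' E] : exists2 s', Y s' & forall v, free v (FOr p q) -> s v = s' v.
        by apply: XY; apply/EX; right.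
      exists s' => [|v Hv]; last by apply: E; right.
      by split=> //; exists s.
    by case=> _ [s' Hs' E]; exists s' => // v Hv; apply: E; right.
- apply: IH; split=> _ [s [a [Hs ->]]].
    have [s' Ys' E] := XY s Hs; exists (upd s' x a); first by exists s', a.
    by move=> v Hv; rewrite /upd; case: eqP => // vx; apply: E.
  have [s' Ys' E] := YX s Hs; exists (upd s' x a); first by exists s', a.
  by move=> v Hv; rewrite /upd; case: eqP => // vx; apply: E.
(* Each [s'] receives the values chosen for all matching [s] together, as set-valued choice
   functions permit. *)
- case=> F [F0 H]; exists (fun s' a => exists s,
    [/\ X s, forall v, v <> x /\ free v p -> s v = s' v & F s a]); split.
    move=> s' /YX[s Xs E]; have [a Fa] := F0 s Xs; by exists a, s.
  apply: IH H; split.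
    move=> _ [s [a [Xs [Fa ->]]]]; have [s' Ys' E] := XY s Xs.
    exists (upd s' x a); first by exists s', a; split=> //; split=> //; exists s.
    by move=> v Hv; rewrite /upd; case: eqP => // vx; apply: E.
  move=> _ [s' [a [Ys' [[s [Xs E Fa]] ->]]]].
  exists (upd s x a); first by exists s, a.
  by move=> v Hv; rewrite /upd; case: eqP => // vx; apply: E.
Qed.

(** * Teams of total assignments *)

(* Sentences do not see the domain of the team, so it suffices to work with
   teams of total assignments. *)
Definition embed M (T : (var -> M) -> Prop) : team M :=
  fun s => exists2 t, T t & s = fun v => Some (t v).

Definition tsat tau M (S : structure tau M) phi (T : (var -> M) -> Prop) : Prop :=
  sat S phi (embed T).

Definition tupd M (t : var -> M) (x : var) (a : M) : var -> M :=
  fun y => if y == x then a else t y.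

Definition tall M (x : var) (T : (var -> M) -> Prop) : (var -> M) -> Prop :=
  fun t' => exists t a, T t /\ t' = tupd t x a.

(** The team is read through [rho], so that a formula with bound variables never has to be renamed
    itself and no capture can arise. *)
Definition comp D (rho : var -> var) (X : (var -> D) -> Prop) : (var -> D) -> Prop :=
  fun s => exists2 t, X t & s = fun v => t (rho v).

Lemma embed_agree M V (T U : (var -> M) -> Prop) :
  agree V T U -> agree V (embed T) (embed U).
Proof.
case=> TU UT; split=> _ [t Ht ->].
  have [u Uu E] := TU t Ht; exists (fun v => Some (u v)); first by exists u.
  by move=> v Vv; rewrite E.
have [u Uu E] := UT t Ht; exists (fun v => Some (u v)); first by exists u.
by move=> v Vv; rewrite E.
Qed.

Lemma tsat_agree tau M (S : structure tau M) phi T U :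
  agree (fun v => free v phi) T U -> tsat S phi T -> tsat S phi U.
Proof. by move=> /embed_agree; apply: sat_agree. Qed.

Lemma comp_agree D V (rho : var -> var) (T U : (var -> D) -> Prop) :
  agree V T U -> agree (fun v => V (rho v)) (comp rho T) (comp rho U).
Proof.
case=> TU UT; split=> _ [t Ht ->].
  have [u Uu E] := TU t Ht; exists (fun v => u (rho v)); first by exists u.
  by move=> v Vv; rewrite E.
have [u Uu E] := UT t Ht; exists (fun v => u (rho v)); first by exists u.
by move=> v Vv; rewrite E.
Qed.

Lemma tall_agree M V x (T U : (var -> M) -> Prop) :
  agree (fun v => v <> x /\ V v) T U -> agree V (tall x T) (tall x U).
Proof.
case=> TU UT; split=> _ [t [a [Ht ->]]].
  have [u Uu E] := TU t Ht; exists (tupd u x a); first by exists u, a.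
  by move=> v Vv; rewrite /tupd; case: eqP => // vx; rewrite E.
have [u Uu E] := UT t Ht; exists (tupd u x a); first by exists u, a.
by move=> v Vv; rewrite /tupd; case: eqP => // vx; rewrite E.
Qed.

(** The element [c] shows that the domain is inhabited, so quantification loses no assignment. *)
Lemma tall_id M V x (T : (var -> M) -> Prop) (c : M) :
  ~ V x -> agree V T (tall x T).
Proof.
move=> Vx; split=> [t Tt|_ [t [a [Tt ->]]]].
  exists (tupd t x c); first by exists t, c.
  by move=> v Vv; rewrite /tupd; case: eqP => // vx; case: Vx; rewrite -vx.
by exists t => // v Vv; rewrite /tupd; case: eqP => // vx; case: Vx; rewrite -vx.
Qed.

(** The two parts of a split of [embed T] consist of embedded assignments and so come from subteams
    of [T]. Locality replaces equality of teams. *)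
Lemma tsat_or tau M (S : structure tau M) p q T :
  tsat S (FOr p q) T <->
  exists Y Z, [/\ forall t, T t <-> Y t \/ Z t, tsat S p Y & tsat S q Z].
Proof.
split=> [[Y [Z [E [Hp Hq]]]]|[Y [Z [E Hp Hq]]]].
  have TE t : T t -> Y (fun v => Some (t v)) \/ Z (fun v => Some (t v)).
    by move=> Tt; apply/E; exists t.
  exists (fun t => T t /\ Y (fun v => Some (t v))).
  exists (fun t => T t /\ Z (fun v => Some (t v))); split.
  - by move=> t; split=> [Tt|[[]|[]] //]; case: (TE t Tt); [left | right].
  - apply: sat_agree Hp; split=> [s Ys|_ [t [Tt Yt] ->]]; last by exists (fun v => Some (t v)).
    have [t Tt Es] : embed T s by apply/E; left.
    by exists s => //; exists t => //; rewrite -Es.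
  - apply: sat_agree Hq; split=> [s Zs|_ [t [Tt Zt] ->]]; last by exists (fun v => Some (t v)).
    have [t Tt Es] : embed T s by apply/E; right.
    by exists s => //; exists t => //; rewrite -Es.
exists (embed Y), (embed Z); split=> // s; split=> [[t /E[Ht|Ht] ->]|[[t Ht ->]|[t Ht ->]]].
- by left; exists t.
- by right; exists t.
- by exists t => //; apply/E; left.
- by exists t => //; apply/E; right.
Qed.

Lemma tsat_all tau M (S : structure tau M) x p T :
  tsat S (FAll x p) T <-> tsat S p (tall x T).
Proof.
have A : agree (fun v => free v p) (embed (tall x T))
   (fun s' => exists s a, embed T s /\ s' = upd s x a).
  split.
    move=> _ [_ [t [a [Tt ->]]] ->].
    exists (upd (fun v => Some (t v)) x a).
      by exists (fun v => Some (t v)), a; split=> //; exists t.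
    by move=> v _; rewrite /tupd /upd; case: eqP.
  move=> _ [_ [a [[t Tt ->] ->]]]; exists (fun v => Some (tupd t x a v)).
    by exists (tupd t x a) => //; exists t, a.
  by move=> v _; rewrite /tupd /upd; case: eqP.
by split; [exact: (sat_agree (agree_sym A)) | exact: (sat_agree A)].
Qed.

(** A choice function and a team [U] with the same restriction as [T] carry the same information:
    [U] is the supplemented team, and conversely the values of [x] in [U] define the choice. This is
    what lets existential blocks be handled as a single choice of team. *)
Lemma tsat_ex tau M (S : structure tau M) x p T :
  tsat S (FEx x p) T <-> exists2 U, agree (fun v => free v (FEx x p)) T U & tsat S p U.
Proof.
split=> [[F [F0 H]]|[U [TU UT] H]].
  exists (fun u => exists t a, [/\ T t, F (fun v => Some (t v)) a & u = tupd t x a]).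
    split=> [t Tt|_ [t [a [Tt Fa ->]]]].
      have [|a Fa] := F0 (fun v => Some (t v)); first by exists t.
      exists (tupd t x a); first by exists t, a.
      by move=> v [vx _]; rewrite /tupd; case: eqP.
    by exists t => // v [vx _]; rewrite /tupd; case: eqP.
  apply: sat_agree H; split.
    move=> _ [_ [a [[t Tt ->] [Fa ->]]]]; exists (fun v => Some (tupd t x a v)).
      by exists (tupd t x a) => //; exists t, a.
    by move=> v _; rewrite /tupd /upd; case: eqP.
  move=> _ [_ [t [a [Tt Fa ->]]] ->].
  exists (upd (fun v => Some (t v)) x a).
    by exists (fun v => Some (t v)), a; split=> //; exists t.
  by move=> v _; rewrite /tupd /upd; case: eqP.
(* The choice set of [s] consists of the values of [x] at all members of [U] matching [s] off
   [x]. *)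
exists (fun s a => exists u, [/\ U u, forall v, free v (FEx x p) -> s v = Some (u v) & u x = a]).
split=> [_ [t /TU[u Uu E] ->]|]; first by exists (u x), u; split=> // v Hv; rewrite E.
apply: sat_agree H; split.
  move=> _ [u Uu ->]; have [t Tt E] := UT u Uu.
  exists (upd (fun v => Some (t v)) x (u x)).
    exists (fun v => Some (t v)), (u x); split; first by exists t.
    by split=> //; exists u; split=> // v Hv; rewrite E.
  by move=> v Hv; rewrite /upd; case: eqP => [->|vx] //; rewrite E.
move=> _ [_ [_ [[t Tt ->] [[u [Uu E <-]] ->]]]].
exists (fun v => Some (u v)); first by exists u.
by move=> v Hv; rewrite /upd; case: eqP => [->|vx] //; rewrite -E.
Qed.

Lemma tsat_all_dummy tau M (S : structure tau M) x p T (c : M) :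
  ~ free x p -> tsat S (FAll x p) T <-> tsat S p T.
Proof.
move=> xp; rewrite tsat_all.
have A := @tall_id M (fun v => free v p) x T c xp.
by split; apply: tsat_agree => //; apply: agree_sym.
Qed.

(** * Renaming in literals, and atoms over total assignments *)

Fixpoint rename tau (rho : var -> var) (t : term tau) : term tau :=
  match t with
  | TVar v => TVar (rho v)
  | TFun f args => TFun (fun i => rename rho (args i))
  end.

Lemma occurs_rename tau rho v (t : term tau) :
  occurs v (rename rho t) -> exists2 w, occurs w t & v = rho w.
Proof.
elim: t => [w -> | f args IH [i /IH[w Hw ->]]]; first by exists w.
by exists w => //; exists i.
Qed.

Lemma evals_inv tau M (S : structure tau M) s t a :
  evals S s t a ->
  match t with
  | TVar v => s v = Some a
  | TFun f args => exists2 vals, forall i, evals S s (args i) (vals i) & a = fun_of S vals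
  end.
Proof. by case=> // f args vals H; exists vals. Qed.

Lemma evals_rename tau M (S : structure tau M) rho (s : assignment M) t a :
  evals S (fun v => s (rho v)) t a <-> evals S s (rename rho t) a.
Proof.
elim: t a => [v | f args IH] a; split=> ev; have /= := evals_inv ev.
- by constructor.
- by constructor.
- by case=> vals H ->; constructor=> i; apply/IH.
- by case=> vals H ->; constructor=> i; apply/IH.
Qed.

(** First-order literals are flat, that is, tested one assignment at a time, so renaming them
    reduces to single assignments. *)
Lemma flat_comp M rho (P Q : assignment M -> Prop) T :
  (forall s, P (fun v => s (rho v)) <-> Q s) ->
  (forall s, embed (comp rho T) s -> P s) <-> (forall s, embed T s -> Q s).
Proof.
move=> PQ; split=> H.
  move=> _ [t Tt ->]; apply/(PQ (fun v => Some (t v))); apply: H.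
  by exists (fun v => t (rho v)) => //; exists t.
by move=> _ [_ [u Tu ->] ->]; apply/(PQ (fun v => Some (u v))); apply: H; exists u.
Qed.

Lemma tsat_eq_var tau M (S : structure tau M) x y T :
  tsat S (FEq (TVar x) (TVar y)) T <-> forall t, T t -> t x = t y.
Proof.
split=> [H t Tt|H _ [t Tt ->]].
  have [|a [ex ey]] := H (fun v => Some (t v)); first by exists t.
  have [] := evals_inv ex; have [] := evals_inv ey.
  by move=> -> ->.
by exists (t x); split; constructor; rewrite // (H t).
Qed.

Lemma tsat_neq_var tau M (S : structure tau M) x y T :
  tsat S (FNeq (TVar x) (TVar y)) T <-> forall t, T t -> t x <> t y.
Proof.
split=> [H t Tt|H _ [t Tt ->]].
  have [|a [b [ex [ey ab]]]] := H (fun v => Some (t v)); first by exists t.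
  have [] := evals_inv ex; have [] := evals_inv ey.
  by move=> -> ->.
by exists (t x), (t y); split; [|split]; [constructor | constructor | apply: H].
Qed.

Lemma tsat_inc tau M (S : structure tau M) n (xs ys : 'I_n -> var) T :
  tsat S (FInc xs ys) T <->
  forall t, T t -> exists2 u, T u & forall i, t (xs i) = u (ys i).
Proof.
split=> [H t Tt|H _ [t Tt ->]].
  have [|_ [[u Uu ->] E]] := H (fun v => Some (t v)); first by exists t.
  by exists u => // i; have [] := E i.
have [u Tu E] := H t Tt; exists (fun v => Some (u v)); split; first by exists u.
by move=> i; rewrite E.
Qed.

(** * Kernels of normal forms: literals, conjunction, existential quantifier *)

(** Index 0 is excluded because [x_0] is reserved for the one universal quantifier. *)
Definition between (m : nat) (v : var) : Prop := 0 < v < m.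

(* [theta] is the kernel of a normal form [∃x_m ... ∃x_(m+n-1) ∀x_0 theta] of
   the formula obtained from [phi] by the renaming [rho] of its free variables
   into [x_1 ... x_(m-1)].  By locality, the lax existential prefix just asks
   for a team that agrees with the given one on [x_1 ... x_(m-1)]. *)
Definition kernel tau (phi : formula tau) rho m n (theta : formula tau) : Prop :=
  [/\ nforall theta = 0,
      forall v, free v theta -> v < m + n
    & forall M (S : structure tau M) T, (exists a b : M, a <> b) ->
        (tsat S phi (comp rho T) <->
         exists2 T', agree (between m) T T' & tsat S (FAll 0 theta) T')].

(** The existential block is empty and [x_0] does not occur in [theta], so the universal quantifier
    is a dummy. *)
Lemma kernel_literal tau (phi theta : formula tau) rho m :
  nforall theta = 0 ->
  (forall v, free v phi -> between m (rho v)) ->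
  (forall v, free v theta -> exists2 w, free w phi & v = rho w) ->
  (forall M (S : structure tau M) T, tsat S phi (comp rho T) <-> tsat S theta T) ->
  exists n theta, kernel phi rho m n theta.
Proof.
move=> qf bd fv E; exists 0, theta.
have bdt v : free v theta -> between m v by case/fv => w /bd ? ->.
split=> // [v /bdt|M S T [c _]]; first by rewrite addn0 => /andP[].
have x0 : ~ free 0 theta by move/bdt.
rewrite E; split=> [H|[T' TT']]; first by exists T; [apply: agree_refl | rewrite (tsat_all_dummy _ _ c)].
rewrite (tsat_all_dummy _ _ c) //; apply: tsat_agree.
exact/agree_sym/(agree_sub bdt).
Qed.

(** The block of [q] starts where that of [p] ends, so the two teams can be chosen in succession.
    Both conjuncts share [x_0], since a universal quantifier distributes over conjunction. *)
Lemma kernel_and tau (p q thp thq : formula tau) rho m np nq :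
  (forall v, free v (FAnd p q) -> between m (rho v)) ->
  kernel p rho m np thp -> kernel q rho (m + np) nq thq ->
  kernel (FAnd p q) rho m (np + nq) (FAnd thp thq).
Proof.
move=> bd [qfp bp Ep] [qfq bq Eq]; split=> [|v [/bp|/bq]|M S T two] /=.
- by rewrite qfp qfq.
- by move=> vm; apply: leq_trans vm _; rewrite leq_add2l leq_addr.
- by rewrite addnA.
have wid v : between m v -> between (m + np) v.
  by case/andP=> v0 vm; rewrite /between v0 (leq_trans vm) // leq_addr.
split=> [[/Ep-/(_ two)[T1 T1T H1] Hq]|[T' TT' [H1 H2]]].
  have : tsat S q (comp rho T1).
    by apply: tsat_agree Hq; apply: agree_sub (comp_agree rho T1T) => v Hv; apply: bd; right.
  case/Eq => // T2 T2T H2; exists T2.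
    by apply: agree_trans T1T _; apply: agree_sub T2T.
  apply/tsat_all; split; last exact/tsat_all.
  (* Apart from [x_0], the variables of [thp] lie below [m + np], where [T2] agrees with [T1]. *)
  move/tsat_all: H1; apply: tsat_agree; apply: tall_agree; apply: agree_sub T2T.
  by move=> v [v0 /bp vm]; rewrite /between lt0n; apply/andP; split=> //; apply/eqP.
have TTr := agree_sym (comp_agree rho TT').
split.
  have : tsat S p (comp rho T') by apply/Ep => //; exists T' => //; apply: agree_refl.
  by apply: tsat_agree; apply: agree_sub TTr => v Hv; apply: bd; left.
have : tsat S q (comp rho T') by apply/Eq => //; exists T' => //; apply: agree_refl.
by apply: tsat_agree; apply: agree_sub TTr => v Hv; apply: bd; right.
Qed.

(** The value of [x] is stored at the fresh index [m], which becomes the first variable of the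
    block. *)
Lemma kernel_ex tau x (p thp : formula tau) rho m n :
  0 < m -> (forall v, free v (FEx x p) -> between m (rho v)) ->
  kernel p (tupd rho x m) m.+1 n thp -> kernel (FEx x p) rho m n.+1 thp.
Proof.
move=> m0 bd [qf bp Ep]; split=> // [v /bp|M S T two]; first by rewrite addnS addSn.
have wid v : between m v -> between m.+1 v.
  by case/andP=> v0 vm; rewrite /between v0 ltnS ltnW.
have neq v : between m v -> (v == m) = false by case/andP=> _ vm; apply: ltn_eqF.
split=> [/tsat_ex[U [TU UT] H]|[T' TT' H]].
  (* [T1] extends each [t] at index [m] by the values of [x] in all members of [U] matching it. *)
  pose T1 t1 := exists t u, [/\ T t, U u, forall v, free v (FEx x p) -> t (rho v) = u v
    & t1 = tupd t m (u x)].
  have agr t u : (forall v, free v (FEx x p) -> t (rho v) = u v) ->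
      forall v, free v p -> tupd t m (u x) (tupd rho x m v) = u v.
    move=> E v Hv; rewrite /tupd; case: (v =P x) => [->|vx]; first by rewrite eqxx.
    by rewrite neq ?E //; apply: bd.
  have /Ep-/(_ two)[T' T1T' H'] : tsat S p (comp (tupd rho x m) T1).
    apply: tsat_agree H; split=> [u Uu|_ [_ [t [u [Tt Uu E ->]]] ->]].
      have [_ [t Tt ->] E] := UT u Uu.
      exists (fun v => tupd t m (u x) (tupd rho x m v)); last by move=> v Hv; rewrite agr.
      by exists (tupd t m (u x)) => //; exists t, u.
    by exists u => // v Hv; rewrite agr.
  exists T' => //; apply: agree_trans (agree_sub wid T1T'); split.
    move=> t Tt; have [|u Uu E] := TU (fun v => t (rho v)); first by exists t.
    exists (tupd t m (u x)); first by exists t, u.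
    by move=> v /neq vm; rewrite /tupd vm.
  move=> _ [t [u [Tt Uu E ->]]]; exists t => // v /neq vm; by rewrite /tupd vm.
apply/tsat_ex; exists (comp (tupd rho x m) T').
  have TT'r : agree (fun v => free v (FEx x p)) (comp rho T) (comp rho T').
    by apply: agree_sub (comp_agree rho TT').
  apply: agree_trans TT'r _.
  split=> _ [t Tt ->].
    exists (fun v => t (tupd rho x m v)); first by exists t.
    by move=> v [vx _]; rewrite /tupd; case: eqP.
  exists (fun v => t (rho v)); first by exists t.
  by move=> v [vx _]; rewrite /tupd; case: eqP.
by apply/Ep => //; exists T' => //; apply: agree_refl.
Qed.

(** * Replacing a universal quantifier by an inclusion atom *)

(** The atom [x_0 x_1 ... x_(m-1) ⊆ x_m x_1 ... x_(m-1)]; position 0 carries the quantified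
    value. *)
Definition universal_atom tau m : formula tau :=
  FInc (fun i : 'I_m => i : var) (fun i : 'I_m => if i == 0 :> nat then m else i).

(** As [x_0] ranges over the domain, the atom requires every value of [x_m] to occur with every row
    [x_1 ... x_(m-1)] of the team. *)
Lemma tsat_universal_atom tau M (S : structure tau M) m T : 0 < m ->
  tsat S (FAll 0 (universal_atom tau m)) T <->
  agree (between m.+1) (tall m T) T.
Proof.
move=> m0; rewrite tsat_all tsat_inc; split=> [H|[H _] _ [t [a [Tt ->]]]].
  split=> [_ [t [a [Tt ->]]]|t Tt]; last first.
    exists (tupd t m (t m)); first by exists t, (t m).
    by move=> v _; rewrite /tupd; case: eqP => [->|].
  have [|_ [u [b [Tu ->]]] E] := H (tupd t 0 a); first by exists t, a.
  exists u => // v /andP[v0]; rewrite ltnS leq_eqVlt => /orP[/eqP->|vm].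
    have := E (Ordinal m0); rewrite /tupd /= eqxx => ->.
    by rewrite (gtn_eqF m0).
  by have := E (Ordinal vm); rewrite /tupd /= (ltn_eqF vm) (gtn_eqF v0) (gtn_eqF v0).
have [|u Tu E] := H (tupd t m a); first by exists t, a.
(* Giving [u] its own value at [x_0] places it in the universally extended team. *)
exists (tupd u 0 (u 0)); first by exists u, (u 0).
move=> i; have im := ltn_ord i; rewrite /tupd /=; case: eqP => i0.
  by rewrite (gtn_eqF m0) -E ?/tupd ?eqxx // /between m0 /=.
case: eqP => // _; rewrite -E ?/tupd ?(ltn_eqF im) //.
by rewrite /between lt0n; apply/andP; split; [apply/eqP | rewrite ltnS ltnW].
Qed.

(** The atom forces the team chosen for [x_m] to be, on [x_1 ... x_m], the universal extension of
    the given team. *)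
Lemma kernel_all tau x (p thp : formula tau) rho m n :
  0 < m -> (forall v, free v (FAll x p) -> between m (rho v)) ->
  kernel p (tupd rho x m) m.+1 n thp ->
  kernel (FAll x p) rho m n.+1 (FAnd (universal_atom tau m) thp).
Proof.
move=> m0 bd [qf bp Ep]; split=> [|v [[i /= iv]|/bp]|M S T two]; first by [].
- have im := ltn_ord i; case: iv => ->; first by apply: ltn_addr.
  by case: eqP => _; [rewrite addnS ltnS leq_addr | apply: ltn_addr].
- by rewrite addnS addSn.
have wid v : between m v -> between m.+1 v.
  by case/andP=> v0 vm; rewrite /between v0 ltnS ltnW.
have neq v : between m v -> (v == m) = false by case/andP=> _ vm; apply: ltn_eqF.
(* Quantifying [x] after reading through [rho] amounts to quantifying [x_m] and then reading [x]
   there. *)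
have A : agree (fun v => free v p) (tall x (comp rho T)) (comp (tupd rho x m) (tall m T)).
  have agr t a v : free v p -> tupd (fun w => t (rho w)) x a v = tupd t m a (tupd rho x m v).
    move=> Hv; rewrite /tupd; case: (v =P x) => [_|vx]; first by rewrite eqxx.
    by rewrite neq //; apply: bd.
  split=> [_ [_ [a [[t Tt ->] ->]]]|_ [_ [t [a [Tt ->]]] ->]].
    exists (fun v => tupd t m a (tupd rho x m v)); last by move=> v Hv; apply: agr.
    by exists (tupd t m a) => //; exists t, a.
  exists (tupd (fun w => t (rho w)) x a); last by move=> v Hv; apply: agr.
  by exists (fun w => t (rho w)), a; split=> //; exists t.
have -> : tsat S (FAll x p) (comp rho T) <-> tsat S p (comp (tupd rho x m) (tall m T)).
  by rewrite tsat_all; split; apply: tsat_agree => //; apply: agree_sym.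
have idm : agree (between m) T (tall m T).
  have [c _] := two; by apply: (@tall_id _ _ _ _ c); rewrite /between ltnn andbF.
have tallm T' : agree (between m) T T' -> agree (between m.+1) (tall m T) (tall m T').
  move=> TT'; apply: tall_agree; apply: agree_sub TT' => v [vm /andP[v0 vm1]].
  by rewrite /between v0 ltn_neqAle -ltnS vm1 andbT; apply/eqP.
(* Both directions compare [T'] with [tall m T] and [tall m T'], which agree on [x_1 ... x_m] once
   [T] and [T'] agree below [m]. *)
rewrite (Ep _ _ _ two); split=> [[T' TT' H]|[T' TT' [U H]]].
  have mTT' : agree (between m) T T' by apply: agree_trans idm (agree_sub wid TT').
  exists T' => //; split=> //; apply/(tsat_universal_atom S T' m0).
  by apply: agree_trans TT'; apply/agree_sym/tallm.
by exists T' => //; apply: agree_trans (proj1 (tsat_universal_atom S T' m0) U); apply: tallm.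
Qed.

(** * Disjunction by means of equality flags *)

(** In general a split below the universal quantifier may separate extensions of one assignment. The
    flags do not involve [x_0], so here all extensions fall on the same side and the quantifier
    passes to each part. *)
Lemma tsat_flagged tau M (S : structure tau M) (th1 th2 : formula tau) x y T :
  x != 0 -> y != 0 ->
  tsat S (FAll 0 (FOr (FAnd (FEq (TVar x) (TVar y)) th1)
                      (FAnd (FNeq (TVar x) (TVar y)) th2))) T <->
  exists T1 T2, [/\ forall t, T t <-> T1 t \/ T2 t,
    forall t, T1 t -> t x = t y, forall t, T2 t -> t x <> t y,
    tsat S (FAll 0 th1) T1 & tsat S (FAll 0 th2) T2].
Proof.
move=> x0 y0; rewrite tsat_all.
have upx (t : var -> M) a : tupd t 0 a x = t x by rewrite /tupd (negbTE x0).
have upy (t : var -> M) a : tupd t 0 a y = t y by rewrite /tupd (negbTE y0).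
split=> [/tsat_or[Y [Z [E [Yxy HY] [Zxy HZ]]]]|[T1 [T2 [E T1xy T2xy H1 H2]]]].
  move/tsat_eq_var in Yxy; move/tsat_neq_var in Zxy.
  have YZ t a : T t -> Y (tupd t 0 a) \/ Z (tupd t 0 a).
    by move=> Tt; apply/E; exists t, a.
  exists (fun t => T t /\ t x = t y), (fun t => T t /\ t x <> t y); split.
  - move=> t; split=> [Tt|[[]|[]] //].
    case: (YZ t (t 0) Tt) => [/Yxy|/Zxy]; rewrite upx upy; by [left | right].
  - by move=> t [].
  - by move=> t [].
  - apply/tsat_all; apply: tsat_agree HY; split=> [u Yu|_ [t [a [[Tt xy] ->]]]].
      have [t [a [Tt Eu]]] : tall 0 T u by apply/E; left.
      exists u => //; exists t, a; split=> //; split=> //.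
      by have := Yxy _ Yu; rewrite Eu upx upy.
    exists (tupd t 0 a) => //.
    by case: (YZ t a Tt) => // /Zxy; rewrite upx upy.
  - apply/tsat_all; apply: tsat_agree HZ; split=> [u Zu|_ [t [a [[Tt xy] ->]]]].
      have [t [a [Tt Eu]]] : tall 0 T u by apply/E; right.
      exists u => //; exists t, a; split=> //; split=> //.
      by have := Zxy _ Zu; rewrite Eu upx upy.
    exists (tupd t 0 a) => //.
    by case: (YZ t a Tt) => // /Yxy; rewrite upx upy.
apply/tsat_or; exists (tall 0 T1), (tall 0 T2); split.
- move=> u; split=> [[t [a [/E[Ht|Ht] ->]]]|[[t [a [Ht ->]]]|[t [a [Ht ->]]]]].
  + by left; exists t, a.
  + by right; exists t, a.
  + by exists t, a; split=> //; apply/E; left.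
  + by exists t, a; split=> //; apply/E; right.
- split; last exact/tsat_all.
  by apply/tsat_eq_var => _ [t [a [Ht ->]]]; rewrite upx upy; apply: T1xy.
- split; last exact/tsat_all.
  by apply/tsat_neq_var => _ [t [a [Ht ->]]]; rewrite upx upy; apply: T2xy.
Qed.

(** The variables [x_m] and [x_(m+1)] serve as flags. Both disjuncts reuse the same variables from
    [m + 2] on, as they concern separate parts of the chosen team. *)
Lemma kernel_or tau (p q thp thq : formula tau) rho m np nq :
  0 < m -> (forall v, free v (FOr p q) -> between m (rho v)) ->
  kernel p rho m.+2 np thp -> kernel q rho m.+2 nq thq ->
  exists n, kernel (FOr p q) rho m n
    (FOr (FAnd (FEq (TVar m) (TVar m.+1)) thp) (FAnd (FNeq (TVar m) (TVar m.+1)) thq)).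
Proof.
(* Two flags plus a bound on both blocks; the sum is generous, since the blocks overlap. *)
move=> m0 bd [qfp bp Ep] [qfq bq Eq]; exists (np + nq).+2; split=> [|v|M S T two] /=.
- by rewrite qfp qfq.
- have mlt : m.+1 < m + (np + nq).+2 by rewrite !addnS !ltnS leq_addr.
  by case=> [[[]|/bp]|[[]|/bq]] => [->|->|vm|->|->|vm] //; try exact: ltnW mlt;
    apply: leq_trans vm _; rewrite !addnS !addSn !ltnS leq_add2l ?leq_addr ?leq_addl.
have wid v : between m v -> between m.+2 v.
  by case/andP=> v0 vm; rewrite /between v0 ltnS ltnW // ltnW.
have m2 : between m.+2 m by rewrite /between m0 /= ltnW.
have m21 : between m.+2 m.+1 by rewrite /between /=.
have m_neq0 : m != 0 by rewrite -lt0n.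
(* The flags of a part may be set to any constants [a] and [b], because [r] is read only below index
   [m]. *)
have flag (r th : formula tau) k Y a b : kernel r rho m.+2 k th ->
    (forall v, free v r -> between m (rho v)) -> tsat S r (comp rho Y) ->
    exists T', [/\ agree (between m) Y T', forall t, T' t -> t m = a /\ t m.+1 = b
      & tsat S (FAll 0 th) T'].
  case=> _ _ Er bdr Hr.
  pose Y1 t := exists2 y, Y y & t = tupd (tupd y m a) m.+1 b.
  have YY1 : agree (between m) Y Y1.
    have E (y : var -> M) v : between m v -> y v = tupd (tupd y m a) m.+1 b v.
      by case/andP=> _ vm; rewrite /tupd !ltn_eqF // ltnW.
    split=> [y Yy|_ [y Yy ->]]; last by exists y => // v /E.
    by exists (tupd (tupd y m a) m.+1 b); [exists y | move=> v /E].
  have /Er-/(_ two)[T' Y1T' H] : tsat S r (comp rho Y1).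
    by apply: tsat_agree Hr; apply: agree_sub (comp_agree rho YY1).
  exists T'; split=> //; first by apply: agree_trans YY1 (agree_sub wid Y1T').
  move=> t /(proj2 Y1T')[_ [y Yy ->] E]; rewrite -!E //.
  by rewrite /tupd !eqxx ltn_eqF.
have free1 v : free v p -> between m (rho v) by move=> Hv; apply: bd; left.
have free2 v : free v q -> between m (rho v) by move=> Hv; apply: bd; right.
split=> [/tsat_or[Y [Z [E Hp Hq]]]|[T' TT' /tsat_flagged]]; last first.
  case=> // T1 [T2 [E _ _ H1 H2]].
  (* A part of [T'] is carried back to the members of [T] that match it below [m]. *)
  pose part (Ti : (var -> M) -> Prop) t :=
    T t /\ exists2 u, Ti u & forall v, between m v -> t v = u v.
  have partE (Ti : (var -> M) -> Prop) : (forall t, Ti t -> T' t) ->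
      agree (between m) Ti (part Ti).
    move=> TiT'; split=> [u Tiu|t [_ [u Tiu Eu]]]; last first.
      by exists u => // v Hv; rewrite Eu.
    have [t Tt Et] := proj2 TT' u (TiT' u Tiu).
    by exists t => [|v /Et //]; split=> //; exists u.
  apply/tsat_or; exists (comp rho (part T1)), (comp rho (part T2)); split.
  - move=> s; split=> [[t Tt ->]|[[t [Tt _] ->]|[t [Tt _] ->]]]; try by exists t.
    have [u /E[Hu|Hu] Eu] := proj1 TT' t Tt; [left | right]; exists t => //;
      by split=> //; exists u.
  - have : tsat S p (comp rho T1) by apply/Ep => //; exists T1 => //; apply: agree_refl.
    apply: tsat_agree; apply: agree_sub (comp_agree rho (partE T1 _)) => // t T1t.
    by apply/E; left.
  - have : tsat S q (comp rho T2) by apply/Eq => //; exists T2 => //; apply: agree_refl.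
    apply: tsat_agree; apply: agree_sub (comp_agree rho (partE T2 _)) => // t T2t.
    by apply/E; right.
(* Two distinct elements are needed for unequal flags: the first part gets [c], [c] and the second
   [c], [d]. *)
have [c [d cd]] := two.
have part (U : (var -> M) -> Prop) : (forall s, U s -> comp rho T s) ->
    agree (fun=> True) U (comp rho (fun t => T t /\ U (fun v => t (rho v)))).
  move=> UT; split=> [s Us|_ [t [Tt Ut] ->]]; last by exists (fun v => t (rho v)).
  have [t Tt Es] := UT s Us; exists s => //; exists t => //; split=> //.
  by rewrite -Es.
have [T1 [YT1 F1 H1]] := flag p thp np _ c c (And3 qfp bp Ep) free1
  (tsat_agree (agree_sub (fun _ _ => I) (part Y (fun s Ys => proj2 (E s) (or_introl Ys)))) Hp).
have [T2 [ZT2 F2 H2]] := flag q thq nq _ c d (And3 qfq bq Eq) free2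
  (tsat_agree (agree_sub (fun _ _ => I) (part Z (fun s Zs => proj2 (E s) (or_intror Zs)))) Hq).
exists (fun t => T1 t \/ T2 t); last first.
  apply/tsat_flagged => //.
  exists T1, T2; split=> // t; first by move/F1=> [-> ->].
  by move/F2=> [-> ->].
case: YT1 ZT2 => YT1 T1Y [ZT2 T2Z]; split=> t.
  move=> Tt; have [Yt|Zt] : Y (fun v => t (rho v)) \/ Z (fun v => t (rho v)).
  + by apply/E; exists t.
  + by have [//|u T1u Eu] := YT1 t; exists u => //; left.
  + by have [//|u T2u Eu] := ZT2 t; exists u => //; right.
by case=> [/T1Y|/T2Z] [u [Tu _] Eu]; exists u.
Qed.

(** * Existence of kernels by induction on the formula *)

(** The induction keeps [rho] and [m] general: quantifiers extend the renaming, and conjunction and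
    disjunction shift the first fresh index. *)
Lemma kernel_exists tau (phi : formula tau) rho m :
  0 < m -> (forall v, free v phi -> between m (rho v)) ->
  exists n theta, kernel phi rho m n theta.
Proof.
have updbd x (p : formula tau) r k : 0 < k ->
    (forall v, v <> x /\ free v p -> between k (r v)) ->
    forall v, free v p -> between k.+1 (tupd r x k v).
  move=> k0 bd v Hv; rewrite /tupd /between; case: eqP => [_|vx].
    by rewrite k0 ltnSn.
  by have /andP[-> vk] := bd v (conj vx Hv); rewrite ltnS ltnW.
elim: phi rho m => [n xs ys|t1 t2|t1 t2|R ts|R ts|p IHp q IHq|p IHp q IHq|x p IH|x p IH]
  rho m m0 bd.
- apply: (@kernel_literal _ _ (FInc (rho \o xs) (rho \o ys))) => //.
    by move=> v [i [->|->]]; [exists (xs i) | exists (ys i)] => //; exists i; auto.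
  move=> M S T; rewrite !tsat_inc; split=> [H t Tt|H _ [t Tt ->]].
    have [|_ [u Uu ->] E] := H (fun v => t (rho v)); first by exists t.
    by exists u.
  by have [u Uu E] := H t Tt; exists (fun v => u (rho v)) => //; exists u.
- apply: (@kernel_literal _ _ (FEq (rename rho t1) (rename rho t2))) => //.
    by move=> v [|] /occurs_rename[w Hw ->]; exists w => //; [left | right].
  move=> M S T; apply: flat_comp => s.
  by split=> -[a [e1 e2]]; exists a; split; apply/(evals_rename S rho s).
- apply: (@kernel_literal _ _ (FNeq (rename rho t1) (rename rho t2))) => //.
    by move=> v [|] /occurs_rename[w Hw ->]; exists w => //; [left | right].
  move=> M S T; apply: flat_comp => s.
  by split=> -[a [b [e1 [e2 ab]]]]; exists a, b; split; [|split| |split] => //;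
    apply/(evals_rename S rho s).
- apply: (@kernel_literal _ _ (FRel (fun i => rename rho (ts i)))) => //.
    by move=> v [i /occurs_rename[w Hw ->]]; exists w => //; exists i.
  move=> M S T; apply: flat_comp => s.
  by split=> -[vals [e r]]; exists vals; split=> // i; apply/(evals_rename S rho s).
- apply: (@kernel_literal _ _ (FNRel (fun i => rename rho (ts i)))) => //.
    by move=> v [i /occurs_rename[w Hw ->]]; exists w => //; exists i.
  move=> M S T; apply: flat_comp => s.
  by split=> -[vals [e r]]; exists vals; split=> // i; apply/(evals_rename S rho s).
- have [v Hv|np [thp Kp]] := IHp rho m m0; first by apply: bd; left.
  have [||nq [thq Kq]] := IHq rho (m + np); first by rewrite addn_gt0 m0.
    move=> v Hv; have /andP[v0 vm] : between m (rho v) by apply: bd; right.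
    by rewrite /between v0 (leq_trans vm) ?leq_addr.
  by exists (np + nq), (FAnd thp thq); apply: kernel_and.
- have wid v : between m v -> between m.+2 v.
    by case/andP=> v0 vm; rewrite /between v0 ltnS ltnW // ltnW.
  have [//|v Hv|np [thp Kp]] := IHp rho m.+2; first by apply/wid/bd; left.
  have [//|v Hv|nq [thq Kq]] := IHq rho m.+2; first by apply/wid/bd; right.
  by have [n K] := kernel_or m0 bd Kp Kq; exists n; eexists; apply: K.
- have [//||n [th K]] := IH (tupd rho x m) m.+1; first exact: updbd.
  by exists n.+1, (FAnd (universal_atom tau m) th); apply: kernel_all.
- have [//||n [th K]] := IH (tupd rho x m) m.+1; first exact: updbd.
  by exists n.+1, th; apply: kernel_ex.
Qed.

(** * Existential prefixes and the normal form of sentences *)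

Fixpoint exs tau m n (A : formula tau) : formula tau :=
  if n is n'.+1 then FEx m (exs m.+1 n' A) else A.

Lemma nforall_exs tau m n (A : formula tau) : nforall (exs m n A) = nforall A.
Proof. by elim: n m => /=. Qed.

Lemma free_exs tau m n (A : formula tau) v :
  free v (exs m n A) -> free v A /\ ~ (m <= v < m + n).
Proof.
elim: n m => [|n IH] m /=.
  by rewrite addn0 => Hv; split=> // /andP[mv]; rewrite ltnNge mv.
case=> /eqP vm /IH[Hv out]; split=> // /andP[mv vmn]; apply: out.
by rewrite ltn_neqAle eq_sym vm mv addSn -addnS.
Qed.

(** Iterating [tsat_ex] gives a chain of agreeing teams, which composes to one agreement; conversely
    the final team can serve at every stage. *)
Lemma tsat_exs tau M (S : structure tau M) m n (A : formula tau) T :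
  tsat S (exs m n A) T <->
  exists2 T', agree (fun v => free v (exs m n A)) T T' & tsat S A T'.
Proof.
elim: n m T => [|n IH] m T.
  split=> [H|[T' TT' H]]; first by exists T => //; apply: agree_refl.
  by apply: tsat_agree H; apply: agree_sym.
rewrite [exs _ _ _]/= tsat_ex; split=> [[U TU /IH[T' UT' H]]|[T' TT' H]].
  by exists T' => //; apply: agree_trans TU (agree_sub _ UT') => v [].
by exists T' => //; apply/IH; exists T' => //; apply: agree_refl.
Qed.

(** Without free variables any two nonempty teams agree vacuously, so the empty assignment may be
    replaced by a constant one. *)
Lemma true_in_tsat tau M (S : structure tau M) phi (c : M) :
  sentence phi -> true_in S phi <-> tsat S phi (fun t => t = fun=> c).
Proof.
move=> closed; have A : agree (fun v => free v phi) (@empty_team M)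
    (embed (fun t => t = fun=> c)).
  split=> s _; last by exists (fun=> None) => // v /closed.
  by exists (fun=> Some c) => [|v /closed //]; exists (fun=> c).
by split; apply: sat_agree => //; apply: agree_sym.
Qed.

Theorem theorem5 : forall (tau : signature) (phi : formula tau),
  sentence phi ->
  exists psi : formula tau, sentence psi /\ nforall psi <= 1 /\ equivalent phi psi.
Proof.
move=> tau phi closed.
(* At [m = 1] the range [between 1] is empty, so the bound on free variables holds exactly because
   [phi] is closed. *)
have [//|v /closed //|n [theta [qf bd E]]] := @kernel_exists tau phi id 1.
have closed' : sentence (exs 1 n (FAll 0 theta)).
  move=> v /free_exs[[/eqP v0 /bd vn]]; apply.
  by rewrite lt0n v0.
exists (exs 1 n (FAll 0 theta)); split=> //; split.
  by rewrite nforall_exs /= qf.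
move=> M S two; have [c _] := two; rewrite !(true_in_tsat _ c) //.
have A : tsat S phi (fun t => t = fun=> c) <->
         tsat S phi (comp id (fun t => t = fun=> c)).
  have C : agree (fun v => free v phi) (fun t : var -> M => t = fun=> c)
      (comp id (fun t => t = fun=> c)).
    by split=> t; [move=> ->; exists (fun=> c) => //; exists (fun=> c) |
      case=> u -> ->; exists (fun=> c)].
  by split; apply: tsat_agree => //; apply: agree_sym.
rewrite A (E _ _ _ two) tsat_exs.
(* Both agreement conditions range over an empty set of variables. *)
split=> -[T' TT' H]; exists T' => //; apply: agree_sub TT'.
  by move=> v /closed'.
by case.
Qed.
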